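(* Assume that $n\ge 3$. Let $(M,D)$ be a contact manifold of dimension $2n+1$ and let $\mathcal M=\langle\theta,d\theta,\omega\rangle$ be a Monge--Ampère system with a Lagrangian pair on $(M,D)$, locally generated by a bi-decomposable $n$-form $\omega$. Then $\mathcal M$ canonically determines the Lagrangian pair $(E_1,E_2)$. Namely, if $(\omega_1,\omega_2)$ (resp. $(\omega_1',\omega_2')$) is a bi-decomposition of $\omega$ for a Lagrangian pair $(E_1,E_2)$ (resp. $(E_1',E_2')$), enjoying the bi-decomposing condition, then $$E_1'=E_1,\quad E_2'=E_2,\qquad\text{or}\qquad E_1'=E_2,\quad E_2'=E_1 .$$
   Context: A contact structure $D$ on a manifold $M$ of dimension $2n+1$ is a subbundle of $TM$ of codimension one, locally given by $D=\{\theta=0\}$ for a $1$-form $\theta$ (a local contact form) such that $d\theta$ is non-degenerate on $D$. A Lagrangian pair $(E_1,E_2)$ is a pair of rank-$n$ subbundles of $D$, each isotropic for $d\theta|_D$ (Lagrangian subbundles), with $D=E_1\oplus E_2$. An $n$-form $\omega$ is bi-decomposable for $(E_1,E_2)$, with bi-decomposition $(\omega_1,\omega_2)$, if $\omega=\omega_1-\omega_2$ for $n$-forms $\omega_1,\omega_2$ satisfying the bi-decomposing condition: $i_u\omega_1=0$ for all $u\in E_2$, $i_v\omega_2=0$ for all $v\in E_1$, $\omega_1|_{E_1}$ is a volume form on $E_1$, and $\omega_2|_{E_2}$ is a volume form on $E_2$. A Monge--Ampère system $\mathcal M$ on $(M,D)$ is an exterior differential system which is locally generated, algebraically, by $\theta$,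 $d\theta$ and an $n$-form $\omega$, where $\theta$ is a local contact form for $D$; that is, locally $\mathcal M=\langle\theta,d\theta,\omega\rangle$, the ideal of exterior differential forms generated by $\theta,d\theta,\omega$. Here $\omega$ is called a local generator. It is a (bi-decomposable) Monge--Ampère system with a Lagrangian pair $(E_1,E_2)$ if around each point of $M$ there is a local generator $\omega$ that is bi-decomposable for $(E_1,E_2)$.
   Formalization: The alternative ''E_1'=E_1, E_2'=E_2 or E_1'=E_2, E_2'=E_1'' is asserted on each connected subset of M (or of the domain of ω), since on a disconnected manifold the pair may be swapped on one component only; for connected M it is the full claim. *)

(* Defs.v *)
From HB Require Import structures.
From mathcomp Require Import all_boot all_order all_algebra.
From mathcomp Require Import all_fingroup.
From mathcomp Require Import all_classical all_reals all_analysis.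
Set Implicit Arguments.
Unset Strict Implicit.
Unset Printing Implicit Defensive.
Import Order.TTheory GRing.Theory Num.Theory.
Import numFieldNormedType.Exports.

Local Open Scope classical_set_scope.
Local Open Scope ring_scope.

Section SmoothMaps.
Context {R : realType} {V W : normedModType R}.

Fixpoint iter_derive (f : V -> W) (vs : seq V) : V -> W :=
  if vs is v :: vs' then iter_derive (fun x => 'D_v f x) vs' else f.

(* C^infinity on O (O is always open below): every iterated directional
   derivative is Frechet differentiable at every point of O. *)
Definition smooth_on (O : set V) (f : V -> W) : Prop :=
  forall (vs : seq V) x, O x -> differentiable (iter_derive f vs) x.

End SmoothMaps.

Section Manifolds.
Context {R : realType} {m : nat}.

Record chart (M : topologicalType) := Chart {
  dom : set M;
  coord : M -> 'rV[R]_m;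
  icoord : 'rV[R]_m -> M;
  open_dom : open dom;
  open_im : open (coord @` dom);
  coordK : forall p, dom p -> icoord (coord p) = p;
  coord_cont : {within dom, continuous coord};
  icoord_cont : {within coord @` dom, continuous icoord} }.

End Manifolds.

Arguments chart R m M : clear implicits.

(* Smooth manifolds of dimension m without boundary.  [chart_at p] is a choice,
   for each point p, of a chart of the atlas around p. *)
Record smooth_manifold (R : realType) (m : nat) := SmoothManifold {
  carrier :> topologicalType;
  manifold_hausdorff : hausdorff_space carrier;
  manifold_second_countable : @second_countable carrier;
  atlas : set (chart R m carrier);
  chart_at : carrier -> chart R m carrier;
  chart_at_atlas : forall p, atlas (chart_at p);
  chart_at_dom : forall p, dom (chart_at p) p;
  atlas_compat : forall c c', atlas c -> atlas c' ->
    smooth_on (coord c @` (dom c `&` dom c')) (coord c' \o icoord c) }.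

Section TensorFields.
Context {R : realType} {m : nat} {M : smooth_manifold R m}.
Implicit Types (p : M) (U : set M) (c : chart R m M).

(* The tangent space at p is 'rV[R]_m: a tangent vector is given by its
   components in the chart [chart_at p].  Components in other charts are obtained
   from the Jacobian of the change of coordinates, which acts on row vectors by
   right multiplication. *)
Definition vfield : Type := M -> 'rV[R]_m.

Definition vfield_in c (X : vfield) (x : 'rV[R]_m) : 'rV[R]_m :=
  let q := icoord c x in
  let c0 := chart_at q in
  X q *m 'J (coord c \o icoord c0) (coord c0 q).

Definition smooth_vfield U (X : vfield) : Prop :=
  forall c, atlas c -> smooth_on (coord c @` (U `&` dom c)) (vfield_in c X).

(* A field of k-covariant tensors; a k-tuple of tangent vectors is a k x m
   matrix, its rows being the vectors. Fields are total on M, but only their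
   values on the open set under consideration matter. *)
Definition cfield (k : nat) : Type := M -> 'M[R]_(k, m) -> R.

(* Same shape as [determinant_multilinear] and [determinant_alternate]. *)
Definition multilinear k (f : 'M[R]_(k, m) -> R) : Prop :=
  forall (A B C : 'M[R]_(k, m)) (i : 'I_k) (b c : R),
    row i A = b *: row i B + c *: row i C ->
    row' i B = row' i A -> row' i C = row' i A ->
    f A = b * f B + c * f C.

Definition alternating k (f : 'M[R]_(k, m) -> R) : Prop :=
  forall (A : 'M[R]_(k, m)) (i j : 'I_k), i != j -> row i A = row j A -> f A = 0.

Definition cfield_in k c (w : cfield k) (x : 'rV[R]_m) (A : 'M[R]_(k, m)) : R :=
  let q := icoord c x in
  w q (A *m 'J (coord (chart_at q) \o icoord c) x).

Definition dform k U (w : cfield k) : Prop :=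
  (forall p, U p -> multilinear (w p) /\ alternating (w p)) /\
  (forall c, atlas c -> forall A : 'M[R]_(k, m),
     smooth_on (coord c @` (U `&` dom c)) (fun x => cfield_in c w x A)).

Definition eq_on_cfield k U (w w' : cfield k) : Prop :=
  forall p, U p -> w p = w' p.

Definition cfield0 k : cfield k := fun _ _ => 0.
Definition cfield_add k (w w' : cfield k) : cfield k :=
  fun p A => w p A + w' p A.
Definition cfield_sub k (w w' : cfield k) : cfield k :=
  fun p A => w p A - w' p A.

(* The normalization for which dx_1 /\ ... /\ dx_k is the determinant. *)
Definition wedge k l (w : cfield k) (w' : cfield l) : cfield (k + l) :=
  fun p A => (k`! * l`!)%:R^-1 *
    \sum_(s : 'S_(k + l))
      (-1) ^+ s * w p (usubmx (row_perm s A)) * w' p (dsubmx (row_perm s A)).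

(* (dw)(v_0,...,v_k) = sum_i (-1)^i D_{v_i} (w(v_0,..,^v_i,..,v_k)), the v_i being
   extended as constant vector fields in the coordinates [chart_at p]. *)
Definition ext_d k (w : cfield k) : cfield k.+1 :=
  fun p A => \sum_(i < k.+1) (-1) ^+ i *
    'D_(row i A) (fun x => cfield_in (chart_at p) w x (row' i A))
      (coord (chart_at p) p).

(* Pointwise interior product i_u f; by convention i_u f = 0 in degree 0. *)
Definition int_prod k (u : 'rV[R]_m) :
    ('M[R]_(k, m) -> R) -> 'M[R]_(k.-1, m) -> R :=
  match k return ('M[R]_(k, m) -> R) -> 'M[R]_(k.-1, m) -> R with
  | 0 => fun _ _ => 0
  | k'.+1 => fun f (A : 'M[R]_(k', m)) => f (col_mx u A)
  end.

Definition subbundle_field : Type := M -> {vspace 'rV[R]_m}.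

Definition smooth_subbundle U (r : nat) (E : subbundle_field) : Prop :=
  forall p, U p -> exists (V : set M) (X : 'I_r -> vfield),
    [/\ open V, V p & V `<=` U] /\
    (forall i, smooth_vfield V (X i)) /\
    (forall q, V q -> \dim (E q) = r /\ E q = (\sum_(i < r) <[X i q]>)%VS).

(* J k is the degree k part of a homogeneous ideal of the algebra of
   differential forms on U. *)
Definition is_ideal U (J : forall k, set (cfield k)) : Prop :=
  [/\ forall k w, J k w -> dform U w,
      forall k w w', J k w -> dform U w' -> eq_on_cfield U w w' -> J k w',
      forall k, J k (@cfield0 k),
      forall k w w', J k w -> J k w' -> J k (cfield_add w w') &
      forall k l (w : cfield k) (w' : cfield l), J k w -> dform U w' ->
        J (k + l)%N (wedge w w') /\ J (l + k)%N (wedge w' w)].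

(* The ideal <theta, dtheta, w> of differential forms on U. *)
Definition generated_ideal U (theta : cfield 1) n (w : cfield n) :
    forall k, set (cfield k) :=
  fun k eta => forall J, is_ideal U J ->
    J 1 theta -> J 2 (ext_d theta) -> J n w -> J k eta.

(* An exterior differential system: a sheaf of homogeneous ideals, closed under
   exterior differentiation. *)
Definition eds (I : set M -> forall k, set (cfield k)) : Prop :=
  [/\ forall U, open U -> is_ideal U (I U),
      forall U k w, open U -> I U k w -> I U k.+1 (ext_d w),
      forall U V k w, open U -> open V -> V `<=` U -> I U k w -> I V k w &
      forall U k w, open U -> dform U w ->
        (forall p, U p -> exists V : set M,
           [/\ open V, V p, V `<=` U & I V k w]) ->
        I U k w].

(* theta is a local contact form on U for the distribution D. *)
Definition contact_form (D : subbundle_field) U (theta : cfield 1) : Prop :=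
  [/\ dform U theta,
      forall p (v : 'rV[R]_m), U p -> (v \in D p) <-> theta p v = 0 &
      forall p (u : 'rV[R]_m), U p -> u \in D p ->
        (forall v, v \in D p -> ext_d theta p (col_mx u v) = 0) -> u = 0].

Definition isotropic (D : subbundle_field) U (E : subbundle_field) : Prop :=
  forall (V : set M) theta, open V -> V `<=` U -> contact_form D V theta ->
    forall p (u v : 'rV[R]_m), V p -> u \in E p -> v \in E p ->
      ext_d theta p (col_mx u v) = 0.

End TensorFields.

Arguments vfield {R m} M.
Arguments cfield {R m} M k.
Arguments subbundle_field {R m} M.

Section MongeAmpere.
Context {R : realType} {n : nat} {M : smooth_manifold R n.*2.+1}.
Implicit Types (U : set M) (D : subbundle_field M) (w : cfield M n).
Implicit Types I : set M -> forall k, set (cfield M k).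

Definition contact_structure D : Prop :=
  smooth_subbundle setT n.*2 D /\
  forall p : M, exists U theta, [/\ open U, U p & contact_form D U theta].

Definition lagrangian_pair D U (E1 E2 : subbundle_field M) : Prop :=
  [/\ smooth_subbundle U n E1, smooth_subbundle U n E2,
      isotropic D U E1, isotropic D U E2 &
      forall p, U p -> D p = (E1 p + E2 p)%VS /\ (E1 p :&: E2 p = 0)%VS].

(* The restriction of f to the n-dimensional subspace E is a volume form. *)
Definition volume_on (E : {vspace 'rV[R]_n.*2.+1})
    (f : 'M[R]_(n, n.*2.+1) -> R) : Prop :=
  exists A : 'M[R]_(n, n.*2.+1), (forall i, row i A \in E) /\ f A != 0.

Definition bi_decomposition U (E1 E2 : subbundle_field M) w
    (w1 w2 : cfield M n) : Prop :=
  [/\ dform U w1, dform U w2 & eq_on_cfield U w (cfield_sub w1 w2)] /\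
  [/\ forall p u A, U p -> u \in E2 p -> int_prod u (w1 p) A = 0,
      forall p v A, U p -> v \in E1 p -> int_prod v (w2 p) A = 0,
      forall p, U p -> volume_on (E1 p) (w1 p) &
      forall p, U p -> volume_on (E2 p) (w2 p)].

(* On U, the system I is <theta, dtheta, w> for some local contact form theta. *)
Definition local_generator D I U w : Prop :=
  exists theta, [/\ contact_form D U theta, dform U w &
    forall V, open V -> V `<=` U ->
      forall k (eta : cfield M k), I V k eta <-> generated_ideal V theta w eta].

Definition monge_ampere D I : Prop :=
  eds I /\
  forall p : M, exists U w, [/\ open U, U p & local_generator D I U w].

Definition monge_ampere_with_pair D I (E1 E2 : subbundle_field M) : Prop :=
  [/\ monge_ampere D I, lagrangian_pair D setT E1 E2 &
      forall p : M, exists U w w1 w2,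
        [/\ open U, U p, local_generator D I U w &
            bi_decomposition U E1 E2 w w1 w2]].

Definition same_unordered_pair (A : set M)
    (E1 E2 E1' E2' : subbundle_field M) : Prop :=
  (forall p, A p -> E1' p = E1 p /\ E2' p = E2 p) \/
  (forall p, A p -> E1' p = E2 p /\ E2' p = E1 p).

End MongeAmpere.

(* Main.v *)
From mathcomp Require Import all_boot all_order all_algebra fingroup perm.
From mathcomp Require Import all_classical all_reals all_analysis.
From mathcomp Require Import ring.
Import Order.TTheory GRing.Theory Num.Theory.
Import numFieldNormedType.Exports.
Require Import Defs.
Set Implicit Arguments.
Unset Strict Implicit.
Unset Printing Implicit Defensive.

Local Open Scope classical_set_scope.

(** At a point, [w = w1 - w2] vanishes as soon as one argument lies in [E1] and
    another one in [E2].  If [w] also has this property for [(E1', E2')], take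
    [x] in [E1'], [y] in [E2'] and the remaining [n - 2 >= 1] arguments in [E1]:
    only [w1] survives, so the projections of [x] and [y] to [E1] are linearly
    dependent.  As these projections together span [E1], one of [E1'], [E2']
    projects to zero, i.e. lies in [E2]; exchanging roles, one of them lies in
    [E1].

    For two different generators [w], [w'] of the system, [w] restricted to [D]
    is [c w'] plus a multiple of [Omega = dtheta'].  Both forms have zero trace
    with respect to [Omega] (compute it in a symplectic frame adapted to the
    respective pair), and in a symplectic basis multiplication by [Omega] is
    adjoint to the trace; so [w - c w'] is orthogonal to itself, and [w = c w']
    on [D].

    Finally [E1'] is transverse to [E2] (resp. to [E1]) on an open set, so the
    alternative between the two cases is constant on connected sets. *)

(** * Alternating multilinear forms, with the rows of a matrix as arguments *)

Section MultilinearForms.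
Local Open Scope ring_scope.
Context {R : realType} {m : nat}.
Implicit Types (u v : 'rV[R]_m) (E : {vspace 'rV[R]_m}).

Definition upd k (A : 'M[R]_(k, m)) (i : 'I_k) v : 'M[R]_(k, m) :=
  \matrix_(a, b) if a == i then v 0 b else A a b.

Lemma row_upd k (A : 'M[R]_(k, m)) i v : row i (upd A i v) = v.
Proof. by apply/rowP => b; rewrite !mxE eqxx. Qed.

Lemma row_upd_ne k (A : 'M[R]_(k, m)) i j v :
  j != i -> row j (upd A i v) = row j A.
Proof. by move=> /negbTE ji; apply/rowP => b; rewrite !mxE ji. Qed.

Lemma row'_upd k (A : 'M[R]_(k, m)) i v : row' i (upd A i v) = row' i A.
Proof. by apply/matrixP => a b; rewrite !mxE eq_sym (negbTE (neq_lift i a)). Qed.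

Lemma upd_row k (A : 'M[R]_(k, m)) i : upd A i (row i A) = A.
Proof. by apply/matrixP => a b; rewrite !mxE; case: eqP => [->|]. Qed.

Lemma updC k (A : 'M[R]_(k, m)) i j u v : i != j ->
  upd (upd A i u) j v = upd (upd A j v) i u.
Proof.
move=> ij; apply/matrixP => a b; rewrite !mxE.
by have [->|//] := eqVneq a j; rewrite eq_sym (negbTE ij).
Qed.

Section Form.
Variables (k : nat) (f : 'M[R]_(k, m) -> R).
Hypothesis fl : multilinear f.

Lemma multilin_upd A i (b c : R) u v :
  f (upd A i (b *: u + c *: v)) = b * f (upd A i u) + c * f (upd A i v).
Proof. by apply: (fl (i := i)); rewrite ?row_upd // !row'_upd. Qed.

Lemma multilin_updD A i u v :
  f (upd A i (u + v)) = f (upd A i u) + f (upd A i v).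
Proof. by have := multilin_upd A i 1 1 u v; rewrite !scale1r !mul1r. Qed.

Lemma multilin_updZ A i (b : R) u : f (upd A i (b *: u)) = b * f (upd A i u).
Proof. by have := multilin_upd A i b 0 u 0; rewrite scale0r mul0r !addr0. Qed.

Lemma multilin_upd0 A i : f (upd A i 0) = 0.
Proof. by have := multilin_updZ A i 0 0; rewrite scale0r mul0r. Qed.

Lemma multilin_upd_sum A i (J : finType) (c : J -> R) (v : J -> 'rV[R]_m) :
  f (upd A i (\sum_j c j *: v j)) = \sum_j c j * f (upd A i (v j)).
Proof.
elim/big_rec2: _ => [|j x y _ <-]; first exact: multilin_upd0.
by rewrite multilin_updD multilin_updZ.
Qed.

Hypothesis fa : Defs.alternating f.

Lemma alt_upd2 A i j u : i != j -> f (upd (upd A i u) j u) = 0.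
Proof.
by move=> ij; apply: (fa ij); rewrite row_upd_ne // !row_upd.
Qed.

Lemma alt_swap A i j u v : i != j ->
  f (upd (upd A i u) j v) = - f (upd (upd A i v) j u).
Proof.
move=> ij; have := alt_upd2 A (u + v) ij.
rewrite multilin_updD !(updC _ _ _ ij) !multilin_updD -!(updC _ _ _ ij).
by rewrite !alt_upd2 // add0r addr0 => /eqP; rewrite addrC addr_eq0 => /eqP.
Qed.

Lemma alt_row_perm (s : 'S_k) A : f (row_perm s A) = (-1) ^+ s * f A.
Proof.
have [ts -> /allP ht] := prod_tpermP s.
elim: ts ht A => [|[x y] ts IH] ht A.
  by rewrite big_nil row_perm1 odd_perm1 expr0 mul1r.
have xy : x != y by apply: (ht (x, y)); rewrite mem_head.
have {}IH B : f (row_perm (\prod_(t <- ts) tperm t.1 t.2) B)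
    = (-1) ^+ (\prod_(t <- ts) tperm t.1 t.2)%g * f B.
  by apply: IH => t tts; apply: ht; rewrite in_cons tts orbT.
rewrite big_cons /= row_permM odd_mul_tperm xy addTb signrN mulNr -IH.
set B := row_perm _ A.
have -> : row_perm (tperm x y) B = upd (upd B x (row y B)) y (row x B).
  apply/matrixP => a b; rewrite !mxE.
  have [->|ay] := eqVneq a y; first by rewrite tpermR.
  have [->|ax] := eqVneq a x; first by rewrite tpermL.
  by rewrite tpermD // eq_sym.
by rewrite alt_swap // upd_row upd_row.
Qed.

End Form.

Lemma multilin_sub k (f g : 'M[R]_(k, m) -> R) (c : R) :
  multilinear f -> multilinear g -> multilinear (fun A => f A - c * g A).
Proof.
move=> fl gl A B C i b d h1 h2 h3.
rewrite (fl _ _ _ _ _ _ h1 h2 h3) (gl _ _ _ _ _ _ h1 h2 h3); ring.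
Qed.

Definition rows_of (J : finType) k (b : J -> 'rV[R]_m) (I : {ffun 'I_k -> J}) :
  'M[R]_(k, m) := \matrix_(i, j) b (I i) 0 j.

Lemma row_rows_of (J : finType) k (b : J -> 'rV[R]_m) (I : {ffun 'I_k -> J}) i :
  row i (rows_of b I) = b (I i).
Proof. by apply/rowP => j; rewrite !mxE. Qed.

Lemma span_vanish (J : finType) (b : J -> 'rV[R]_m) E k (f : 'M[R]_(k, m) -> R) :
  multilinear f ->
  (forall v, v \in E -> exists c : J -> R, v = \sum_j c j *: b j) ->
  (forall I, f (rows_of b I) = 0) ->
  forall A, (forall i, row i A \in E) -> f A = 0.
Proof.
move=> fl spanE f0 A AE.
(* the first [d] rows are arbitrary, the remaining ones are members of [b] *)
suff H d (B : 'M[R]_(k, m)) : (forall i : 'I_k, (i < d)%N -> row i B \in E) ->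
    (forall i : 'I_k, (d <= i)%N -> exists j, row i B = b j) -> f B = 0.
  by apply: (H k) => // i; rewrite leqNgt ltn_ord.
elim: d B => [|d IH] B h1 h2.
  have /choice [I hI] i : exists j, row i B = b j by exact: h2.
  rewrite -(f0 (finfun I)); congr f; apply/row_matrixP => i.
  by rewrite row_rows_of ffunE.
have [dk|kd] := ltnP d k; last first.
  apply: IH => i hi; first by apply: h1; rewrite ltnS ltnW.
  by have := leq_ltn_trans (leq_trans kd hi) (ltn_ord i); rewrite ltnn.
pose i := Ordinal dk.
have [c hc] := spanE _ (h1 i (ltnSn d)).
rewrite -(upd_row B i) hc multilin_upd_sum // big1 // => j _.
rewrite IH ?mulr0 // => a had.
  by rewrite row_upd_ne ?h1 1?ltnW // -val_eqE neq_ltn had.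
have [->|ai] := eqVneq a i; first by exists j; rewrite row_upd.
by rewrite row_upd_ne //; apply: h2; rewrite ltn_neqAle had andbT eq_sym.
Qed.

(** [int_prod] puts its vector in slot 0; a transposition brings row [i] there at the cost of a
    sign. *)
Lemma int_prod_row k (f : 'M[R]_(k, m) -> R) E :
  multilinear f -> Defs.alternating f ->
  (forall u A, u \in E -> int_prod u f A = 0) ->
  forall A i, row i A \in E -> f A = 0.
Proof.
case: k f => [f _ _ _ A []//|k f fl fa h A i hi].
have {}h B : row ord0 B \in E -> f B = 0.
  move=> Br; rewrite -(h _ (@dsubmx _ 1 k m B) Br) /=; congr f.
  rewrite -[LHS](@vsubmxK _ 1 k); apply: (congr2 (@col_mx R 1 k m)) => //.
  by apply/rowP => j; rewrite !mxE; congr (B _ _); apply/val_inj.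
have := alt_row_perm fl fa (tperm ord0 i) A.
rewrite h; first by move/esym/eqP; rewrite mulf_eq0 signr_eq0 => /eqP.
by rewrite (_ : row _ _ = row i A) //; apply/rowP => j; rewrite !mxE tpermL.
Qed.

End MultilinearForms.

(** * The ideal of a Monge-Ampère system, seen at one point *)

Section PointwiseIdeal.
Local Open Scope ring_scope.
Context {R : realType} {m : nat}.

(* The restrictions to a point of the exterior multiples of [g0] are sums of
   such functions, one for each choice [phi] of the arguments fed to [g0]. *)
Definition multiple d (g0 : 'M[R]_(d, m) -> R) k (g : 'M[R]_(k, m) -> R) : Prop :=
  exists (phi : 'I_d -> 'I_k) (h : 'M[R]_(k, m) -> R),
    [/\ injective phi, forall i A v, h (upd A (phi i) v) = h A &
        forall A, g A = g0 (rowsub phi A) * h A].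

(** The cofactors [h] in [multiple] are arbitrary functions of the remaining rows, so every single
    term of the sum over permutations defining [wedge] belongs to the ideal, not just the
    antisymmetrised sum. *)
Inductive alg_ideal (th : 'M[R]_(1, m) -> R) (Om : 'M[R]_(2, m) -> R) n
    (w0 : 'M[R]_(n, m) -> R) k (g : 'M[R]_(k, m) -> R) : Prop :=
| AlgZero of forall A, g A = 0
| AlgTh of multiple th g
| AlgOm of multiple Om g
| AlgW of multiple w0 g
| AlgAdd g1 g2 of alg_ideal th Om w0 g1 & alg_ideal th Om w0 g2 &
    forall A, g A = g1 A + g2 A.

Lemma rowsub_upd k K (psi : 'I_k -> 'I_K) (A : 'M[R]_(K, m)) i v :
  injective psi -> rowsub psi (upd A (psi i) v) = upd (rowsub psi A) i v.
Proof. by move=> psiI; apply/matrixP => a b; rewrite !mxE (inj_eq psiI). Qed.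

Lemma multiple_rowsub d (g0 : 'M[R]_(d, m) -> R) k (g : 'M[R]_(k, m) -> R) K
    (psi : 'I_k -> 'I_K) (h' : 'M[R]_(K, m) -> R) :
  injective psi -> (forall i A v, h' (upd A (psi i) v) = h' A) ->
  multiple g0 g -> multiple g0 (fun A => g (rowsub psi A) * h' A).
Proof.
move=> psiI h'i [phi [h [phiI hi gE]]].
exists (psi \o phi), (fun A => h (rowsub psi A) * h' A); split.
- exact: inj_comp.
- by move=> i A v /=; rewrite h'i rowsub_upd // hi.
- move=> A; rewrite gE mulrA; congr (g0 _ * _ * _).
  by apply/matrixP => a b; rewrite !mxE.
Qed.

Lemma multiple_id d (g0 : 'M[R]_(d, m) -> R) : multiple g0 g0.
Proof.
exists id, (fun=> 1); split=> // A; rewrite mulr1; congr g0.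
by apply/matrixP => a b; rewrite !mxE.
Qed.

Section Ideal.
Variables (th : 'M[R]_(1, m) -> R) (Om : 'M[R]_(2, m) -> R) (n : nat).
Variable (w0 : 'M[R]_(n, m) -> R).

Lemma alg_ideal_rowsub k (g : 'M[R]_(k, m) -> R) K (psi : 'I_k -> 'I_K)
    (h' : 'M[R]_(K, m) -> R) :
  injective psi -> (forall i A v, h' (upd A (psi i) v) = h' A) ->
  alg_ideal th Om w0 g -> alg_ideal th Om w0 (fun A => g (rowsub psi A) * h' A).
Proof.
move=> psiI h'i; elim=> {g} [g g0|g gm|g gm|g gm|g g1 g2 _ I1 _ I2 gE].
- by apply: AlgZero => A; rewrite g0 mul0r.
- exact/AlgTh/multiple_rowsub.
- exact/AlgOm/multiple_rowsub.
- exact/AlgW/multiple_rowsub.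
- by apply: (AlgAdd I1 I2) => A; rewrite gE mulrDl.
Qed.

Lemma alg_ideal_sum (J : finType) k (g : J -> 'M[R]_(k, m) -> R) (c : R) :
  (forall j, alg_ideal th Om w0 (g j)) ->
  alg_ideal th Om w0 (fun A => c * \sum_j g j A).
Proof.
move=> gI; suff H s : alg_ideal th Om w0 (fun A => c * \sum_(j <- s) g j A).
  exact: H.
elim: s => [|j s IH]; first by apply: AlgZero => A; rewrite big_nil mulr0.
have cg : alg_ideal th Om w0 (fun A => g j (rowsub id A) * c).
  exact: alg_ideal_rowsub.
apply: (AlgAdd cg IH) => A; rewrite big_cons mulrDr mulrC; congr (g j _ * c + _).
by apply/matrixP => a b; rewrite !mxE.
Qed.

Lemma alg_ideal_wedgel (M : smooth_manifold R m) k l (w : cfield M k)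
    (w' : cfield M l) p :
  alg_ideal th Om w0 (w p) -> alg_ideal th Om w0 (wedge w w' p).
Proof.
move=> wI; apply: alg_ideal_sum => s.
pose psi i := s (lshift l i).
pose h' (A : 'M[R]_(k + l, m)) := (-1) ^+ s * w' p (dsubmx (row_perm s A)).
have -> : (fun A => (-1) ^+ s * w p (usubmx (row_perm s A)) *
      w' p (dsubmx (row_perm s A))) = fun A => w p (rowsub psi A) * h' A.
  apply/funext => A; rewrite /h' mulrCA mulrA; congr (_ * w p _ * _).
  by apply/matrixP => a b; rewrite !mxE.
apply: alg_ideal_rowsub wI => [i j /perm_inj /lshift_inj //|i A v].
congr (_ * w' p _); apply/matrixP => a b; rewrite !mxE (inj_eq perm_inj).
by rewrite eq_rlshift.
Qed.

Lemma alg_ideal_wedger (M : smooth_manifold R m) k l (w : cfield M k)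
    (w' : cfield M l) p :
  alg_ideal th Om w0 (w p) -> alg_ideal th Om w0 (wedge w' w p).
Proof.
move=> wI; apply: alg_ideal_sum => s.
pose psi i := s (rshift l i).
pose h' (A : 'M[R]_(l + k, m)) := (-1) ^+ s * w' p (usubmx (row_perm s A)).
have -> : (fun A => (-1) ^+ s * w' p (usubmx (row_perm s A)) *
      w p (dsubmx (row_perm s A))) = fun A => w p (rowsub psi A) * h' A.
  apply/funext => A; rewrite /h' mulrC; congr (w p _ * _).
  by apply/matrixP => a b; rewrite !mxE.
apply: alg_ideal_rowsub wI => [i j /perm_inj /rshift_inj //|i A v].
congr (_ * w' p _); apply/matrixP => a b; rewrite !mxE (inj_eq perm_inj).
by rewrite eq_lrshift.
Qed.

End Ideal.

Section Slots.
Variables (J : finType) (k : nat).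

Definition fupd (I : {ffun 'I_k -> J}) a x : {ffun 'I_k -> J} :=
  [ffun i => if i == a then x else I i].

Lemma rows_of_fupd (b : J -> 'rV[R]_m) I a x :
  rows_of b (fupd I a x) = upd (rows_of b I) a (b x).
Proof. by apply/matrixP => i j; rewrite !mxE ffunE; case: ifP. Qed.

Lemma sum_fupd (G : {ffun 'I_k -> J} -> R) a :
  \sum_I \sum_x G (fupd I a x) = #|J|%:R * \sum_I G I.
Proof.
(* The reindexing exchanges the new value [x] with the old value [I a]; it is an involution, and
   after it the summand is [G I] for every [x]. *)
rewrite pair_bigA /= (reindex_inj (h := fun q : {ffun 'I_k -> J} * J =>
  (fupd q.1 a q.2, q.1 a))) /=; last first.
  apply: (can_inj (g := fun q => (fupd q.1 a q.2, q.1 a))) => -[I x] /=.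
  by congr pair; [apply/ffunP => i|]; rewrite !ffunE ?eqxx //; case: eqP => // ->.
rewrite -(pair_bigA _ (fun I x => G (fupd (fupd I a x) a (I a)))) /=.
rewrite mulr_sumr; apply: eq_bigr => I _.
rewrite (eq_bigr (fun=> G I)) ?sumr_const ?mulr_natl // => x _.
by congr G; apply/ffunP => i; rewrite !ffunE; case: eqP => // ->.
Qed.

(** Resampling slots [a] and [c] multiplies the full sum by the square of [#|J|], which is
    invertible in characteristic 0; so the partial sums over two slots decide. *)
Lemma sum_fupd2_eq0 (G : {ffun 'I_k -> J} -> R) a c :
  (forall I, \sum_x \sum_y G (fupd (fupd I a x) c y) = 0) ->
  (0 < #|J|)%N -> \sum_I G I = 0.
Proof.
move=> G0 J0; have {}J0 : #|J|%:R != 0 :> R by rewrite pnatr_eq0 -lt0n.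
apply: (mulfI J0); rewrite mulr0 -(sum_fupd _ c); apply: (mulfI J0).
rewrite mulr0 -(sum_fupd _ a) big1 // => I _; exact: G0.
Qed.
End Slots.

Lemma rowsub1 k (phi : 'I_1 -> 'I_k) (A : 'M[R]_(k, m)) :
  rowsub phi A = row (phi ord0) A.
Proof. by apply/matrixP => i j; rewrite !mxE !ord1. Qed.

Lemma rowsub2 k (phi : 'I_2 -> 'I_k) (A : 'M[R]_(k, m)) :
  rowsub phi A = col_mx (row (phi ord0) A) (row (phi ord_max) A).
Proof.
apply/matrixP => i j; rewrite !mxE.
by case: (@splitP 1 1 i) => i' hi; rewrite !mxE; congr (A (phi _) _);
  apply/val_inj; rewrite /= hi ord1.
Qed.

(* A top degree element of the ideal is a multiple of [w0] up to terms divisible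
   by [Om], and these are orthogonal, for the scalar product of coefficients in
   the basis [b], to the forms [F] whose contraction with [Om] vanishes. *)
Lemma alg_ideal_orthogonal (J : finType) (b : J -> 'rV[R]_m) th Om n
    (w0 g : 'M[R]_(n, m) -> R) :
  (0 < #|J|)%N -> (forall j, th (b j) = 0) ->
  multilinear w0 -> Defs.alternating w0 -> alg_ideal th Om w0 g ->
  exists c : R, forall F : 'M[R]_(n, m) -> R,
    (forall A a a', a != a' ->
       \sum_x \sum_y
         Om (col_mx (b x) (b y)) * F (upd (upd A a (b x)) a' (b y)) = 0) ->
    \sum_I F (rows_of b I) * (g (rows_of b I) - c * w0 (rows_of b I)) = 0.
Proof.
move=> J0 th0 w0l w0a; elim=> {g} [g g0|g gm|g gm|g gm|g g1 g2 _ [c1 I1] _ [c2 I2] gE].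
- by exists 0 => F _; apply: big1 => I _; rewrite g0 mul0r subr0 mulr0.
- have [phi [h [_ _ gE]]] := gm.
  exists 0 => F _; apply: big1 => I _.
  by rewrite gE rowsub1 row_rows_of th0 !mul0r subr0 mulr0.
- have [phi [h [phiI hi gE]]] := gm.
  exists 0 => F F0; set a := phi ord0; set a' := phi ord_max.
  have aa' : a != a' by rewrite (inj_eq phiI).
  (* Multi-indices are grouped by their values outside [a] and [a']. The cofactor [h] is constant on
     a group, and what it multiplies is the contraction of [F] with [Om]. *)
  apply: (sum_fupd2_eq0 (a := a) (c := a')) => // I.
  rewrite -[RHS](mulr0 (h (rows_of b I))) -[in RHS](F0 (rows_of b I) _ _ aa') mulr_sumr.
  apply: eq_bigr => x _; rewrite mulr_sumr; apply: eq_bigr => y _.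
  rewrite mul0r subr0 gE rowsub2 !rows_of_fupd !hi row_upd row_upd_ne // row_upd.
  by rewrite mulrC mulrAC mulrC.
- have [phi [h [phiI hi gE]]] := gm.
  (* Here [phi] is an injection of ['I_n] into itself, hence a permutation, so [h] ignores every
     row. Erasing the rows one by one shows that [h] is constant, and [g] is a scalar multiple of
     [w0]. *)
  have hu i A v : h (upd A i v) = h A.
    by have := hi (invF phiI i) A v; rewrite f_invF.
  have hd d A : h A = h (\matrix_(i, j) if (i < d)%N then 0 else A i j).
    elim: d => [|d ->]; first by congr h; apply/matrixP => i j; rewrite !mxE.
    have [dn|nd] := ltnP d n.
      rewrite -(hu (Ordinal dn) _ 0); congr h; apply/matrixP => i j; rewrite !mxE.
      by rewrite -val_eqE /= ltnS [in RHS]leq_eqVlt; case: eqP.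
    congr h; apply/matrixP => i j; rewrite !mxE.
    by rewrite ltnS (leq_trans (ltn_ord i) nd) ltnW // (leq_trans (ltn_ord i) nd).
  have hc A : h A = h 0.
    by rewrite (hd n); congr h; apply/matrixP => i j; rewrite !mxE ltn_ord.
  exists ((-1) ^+ perm phiI * h 0) => F _; apply: big1 => I _.
  rewrite gE hc -[rowsub _ _](_ : row_perm (perm phiI) (rows_of b I) = _).
    by rewrite alt_row_perm // -!mulrA [h 0 * _]mulrC subrr mulr0.
  by apply/matrixP => i j; rewrite !mxE permE.
- exists (c1 + c2) => F F0.
  rewrite (eq_bigr (fun I => F (rows_of b I) * (g1 (rows_of b I) - c1 * w0 (rows_of b I))
      + F (rows_of b I) * (g2 (rows_of b I) - c2 * w0 (rows_of b I)))).
    by rewrite big_split /= I1 // I2 // addr0.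
  by move=> I _; rewrite gE; ring.
Qed.

End PointwiseIdeal.

(** * Symplectic frames adapted to a Lagrangian pair, and traces *)

Lemma vspace_basis (K : fieldType) (vT : vectType K) (E : {vspace vT}) n :
  \dim E = n -> exists e : 'I_n -> vT,
    [/\ forall i, e i \in E,
        forall v, v \in E -> exists c : 'I_n -> K, v = (\sum_i c i *: e i)%R &
        forall c : 'I_n -> K, (\sum_i c i *: e i = 0 -> forall i, c i = 0)%R].
Proof.
case: n /; exists (fun i => (vbasis E)`_i)%R; split=> [i|v vE|c].
- by apply/vbasis_mem/mem_nth; rewrite size_tuple.
- by exists (fun i => vector.coord (vbasis E) i v); exact: coord_vbasis.
- exact/freeP/basis_free/vbasisP.
Qed.

Section SymplecticFrames.
Local Open Scope ring_scope.
Context {R : realType} {m : nat}.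
Implicit Types (u v : 'rV[R]_m) (D E : {vspace 'rV[R]_m}).

Definition separated k E1 E2 (w : 'M[R]_(k, m) -> R) : Prop :=
  forall A i j, i != j -> row i A \in E1 -> row j A \in E2 -> w A = 0.

Definition isotropic_for (om : 'rV[R]_m -> 'rV[R]_m -> R) E : Prop :=
  forall u v, u \in E -> v \in E -> om u v = 0.

Definition splits D n E1 E2 : Prop :=
  [/\ \dim E1 = n, \dim E2 = n, D = (E1 + E2)%VS & (E1 :&: E2 = 0)%VS].

Section Frames.
Variable om : 'rV[R]_m -> 'rV[R]_m -> R.
Hypothesis om_lin : forall a u v w, om (a *: u + v) w = a * om u w + om v w.
Hypothesis om_skew : forall u v, om u v = - om v u.

Lemma om_suml (J : finType) (c : J -> R) (x : J -> 'rV[R]_m) v :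
  om (\sum_j c j *: x j) v = \sum_j c j * om (x j) v.
Proof.
elim/big_rec2: _ => [|j y z _ <-]; last by rewrite om_lin.
by have := om_lin (-1) 0 0 v; rewrite scaler0 addr0 mulN1r addNr.
Qed.

Lemma om_sumr (J : finType) (c : J -> R) (x : J -> 'rV[R]_m) v :
  om v (\sum_j c j *: x j) = \sum_j c j * om v (x j).
Proof.
by rewrite om_skew om_suml -sumrN; apply: eq_bigr => j _; rewrite om_skew mulrN opprK.
Qed.

Lemma omDl u v w : om (u + v) w = om u w + om v w.
Proof. by rewrite -[u]scale1r om_lin scale1r mul1r. Qed.

Lemma omDr u v w : om w (u + v) = om w u + om w v.
Proof. by rewrite om_skew omDl opprD -!(om_skew w). Qed.

Lemma omNl u w : om (- u) w = - om u w.
Proof.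
have := om_lin (-1) u 0 w; rewrite addr0 scaleN1r mulN1r => ->.
by have := om_suml (fun i : 'I_0 => 0) (fun=> 0) w; rewrite !big_ord0 => ->; rewrite addr0.
Qed.

Lemma omNr u w : om w (- u) = - om w u.
Proof. by rewrite om_skew omNl -om_skew. Qed.

(** Duality with respect to [om] is expressed by the two expansions, which are what a change of
    frame in a trace uses. *)
Record dual_frame D (J : finType) (b bs : J -> 'rV[R]_m) : Prop := DualFrame {
  frame_in : forall j, b j \in D;
  dual_frame_in : forall j, bs j \in D;
  frame_expand : forall v, v \in D -> v = \sum_j om v (bs j) *: b j;
  dual_frame_expand : forall v, v \in D -> v = \sum_j om (b j) v *: bs j }.

(** Expand [b' j] in the frame [b], move the coefficients [om (b' j) (bs i)] to the second argument
    of [F], and resum them over [j] into [bs i]. *)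
Lemma frame_trace D (J J' : finType) (b bs : J -> 'rV[R]_m) (b' bs' : J' -> 'rV[R]_m)
    (F : 'rV[R]_m -> 'rV[R]_m -> R) :
  dual_frame D b bs -> dual_frame D b' bs' ->
  (forall (I : finType) (c : I -> R) x v, F (\sum_i c i *: x i) v = \sum_i c i * F (x i) v) ->
  (forall (I : finType) (c : I -> R) x v, F v (\sum_i c i *: x i) = \sum_i c i * F v (x i)) ->
  \sum_j F (b j) (bs j) = \sum_j F (b' j) (bs' j).
Proof.
move=> fr fr' Fl Fr.
under [RHS]eq_bigr => j _ do rewrite (frame_expand fr (frame_in fr' j)) Fl.
rewrite exchange_big /=; apply: eq_bigr => i _.
by rewrite -Fr -(dual_frame_expand fr' (dual_frame_in fr i)).
Qed.

Section Adapted.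
Variables (n : nat) (D E1 E2 : {vspace 'rV[R]_m}).
Hypothesis om_nondeg : forall u, u \in D -> (forall v, v \in D -> om u v = 0) -> u = 0.
Hypotheses (E1E2 : splits D n E1 E2).
Hypotheses (iso1 : isotropic_for om E1) (iso2 : isotropic_for om E2).

(** Since [E1] and [E2] are isotropic, [om] on [D] is carried by the matrix [P] of its values
    between a basis of [E1] and one of [E2]. Non-degeneracy makes [P] invertible, and its inverse
    turns the second basis into the dual of the first. *)
Lemma symplectic_basis : exists e f : 'I_n -> 'rV[R]_m,
  [/\ forall i, e i \in E1, forall i, f i \in E2,
      forall i j, om (e i) (f j) = (i == j)%:R &
      forall v, v \in D -> exists x y : 'I_n -> R,
        v = \sum_i x i *: e i + \sum_i y i *: f i].
Proof.
have [d1 d2 DE _] := E1E2.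
have [e [eE espan efree]] := vspace_basis d1.
have [g [gE gspan _]] := vspace_basis d2.
have sub1 v : v \in E1 -> v \in D by move=> vE; rewrite DE (subvP (addvSl _ _)).
have sub2 v : v \in E2 -> v \in D by move=> vE; rewrite DE (subvP (addvSr _ _)).
pose P : 'M[R]_n := \matrix_(i, j) om (e i) (g j).
have Pu : P \in unitmx.
  rewrite unitmxE unitfE; apply/det0P => -[x x0 xP].
  move/eqP: x0; apply; apply/rowP => i; rewrite mxE.
  apply: (efree (fun i => x 0 i)); apply: om_nondeg => [|v].
    by apply: memv_suml => j _; rewrite memvZ // sub1.
  rewrite DE => /memv_addP [v1 v1E [v2 /gspan [c ->] ->]].
  rewrite omDr om_sumr [X in _ + X]big1 ?addr0 => [|j _].
    by apply: iso1 => //; apply: memv_suml => j _; rewrite memvZ.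
  have /rowP/(_ j) := xP; rewrite !mxE om_suml => xPj.
  by rewrite -[RHS](mulr0 (c j)) -[in RHS]xPj; congr (_ * _); apply: eq_bigr => k _; rewrite mxE.
pose f j := \sum_k invmx P k j *: g k.
exists e, f; split=> // [i|i j|v].
- by apply: memv_suml => k _; rewrite memvZ.
- rewrite om_sumr; transitivity ((P *m invmx P) i j); last by rewrite mulmxV // mxE.
  by rewrite mxE; apply: eq_bigr => k _; rewrite mxE mulrC.
rewrite DE => /memv_addP [v1 /espan [x ->] [v2 /gspan [c ->] ->]].
exists x, (fun j => \sum_k P j k * c k); congr (_ + _).
under [RHS]eq_bigr => j _ do rewrite /f scaler_sumr.
rewrite exchange_big /=; apply: eq_bigr => k _.
under eq_bigr => j _ do rewrite scalerA.
rewrite -scaler_suml; congr (_ *: _).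
transitivity (\sum_l (invmx P *m P) k l * c l).
  rewrite mulVmx // (bigD1 k) //= mxE eqxx mul1r big1 ?addr0 // => l lk.
  by rewrite mxE eq_sym (negbTE lk) mul0r.
under eq_bigr => l _ do rewrite mxE mulr_suml.
rewrite exchange_big /=; apply: eq_bigr => j _.
by rewrite mulr_suml; apply: eq_bigr => l _; ring.
Qed.

(** The frame is a symplectic basis (e, f), with dual frame (f, -e). The second clause turns a
    contraction with the coefficients of [om] in the basis [b] into the trace over the pairs [b j],
    [bs j]. *)
Lemma adapted_frame : exists b bs : 'I_n + 'I_n -> 'rV[R]_m,
  [/\ dual_frame D b bs,
      forall j, bs j = \sum_k om (b j) (b k) *: b k &
      forall j, (b j \in E1) && (bs j \in E2) || (b j \in E2) && (bs j \in E1)].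
Proof.
have [e [f [eE fE ef Dspan]]] := symplectic_basis.
have [_ _ DE _] := E1E2.
have sub1 v : v \in E1 -> v \in D by move=> vE; rewrite DE (subvP (addvSl _ _)).
have sub2 v : v \in E2 -> v \in D by move=> vE; rewrite DE (subvP (addvSr _ _)).
have ee i j : om (e i) (e j) = 0 by exact: iso1.
have ff i j : om (f i) (f j) = 0 by exact: iso2.
have fe i j : om (f i) (e j) = - (j == i)%:R by rewrite om_skew ef.
have sumd (x : 'I_n -> R) i : \sum_j x j * (j == i)%:R = x i.
  rewrite (bigD1 i) //= eqxx mulr1 big1 ?addr0 // => j /negbTE ->; exact: mulr0.
have sumdv (x : 'I_n -> 'rV[R]_m) i : \sum_j (i == j)%:R *: x j = x i.
  rewrite (bigD1 i) //= eqxx scale1r big1 ?addr0 // => j ji.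
  by rewrite eq_sym (negbTE ji) scale0r.
pose b (j : 'I_n + 'I_n) := match j with inl i => e i | inr i => f i end.
pose bs (j : 'I_n + 'I_n) := match j with inl i => f i | inr i => - e i end.
exists b, bs; split; last by case=> i /=; rewrite ?rpredN ?eE ?fE ?orbT.
  have coef v : v \in D ->
      v = \sum_i om v (f i) *: e i + \sum_i om (e i) v *: f i.
    move=> /Dspan [x [y ->]]; congr (_ + _); apply: eq_bigr => i _; congr (_ *: _).
      rewrite omDl !om_suml [X in _ + X]big1 ?addr0; last by move=> j _; rewrite ff mulr0.
      by under eq_bigr => j _ do rewrite ef; rewrite sumd.
    rewrite omDr !om_sumr [X in X + _]big1 ?add0r; last by move=> j _; rewrite ee mulr0.
    by under eq_bigr => j _ do rewrite ef eq_sym; rewrite sumd.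
  split=> [[i|i]|[i|i]|v vD|v vD] /=; rewrite ?rpredN; auto.
    rewrite big_sumType /= {1}(coef _ vD); congr (_ + _); apply: eq_bigr => i _.
    by rewrite omNr -om_skew.
  rewrite big_sumType /= {1}(coef _ vD) addrC; congr (_ + _); apply: eq_bigr => i _.
  by rewrite scalerN -scaleNr -om_skew.
move=> [i|i]; rewrite big_sumType /=.
  rewrite big1 ?add0r; last by move=> j _; rewrite ee scale0r.
  by under eq_bigr => j _ do rewrite ef; rewrite sumdv.
rewrite [X in _ + X]big1 ?addr0; last by move=> j _; rewrite ff scale0r.
by under eq_bigr => j _ do rewrite fe eq_sym scaleNr; rewrite sumrN sumdv.
Qed.

Lemma separated_trace k (w : 'M[R]_(k, m) -> R) (J : finType) (b bs : J -> 'rV[R]_m) :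
  separated E1 E2 w ->
  (forall j, (b j \in E1) && (bs j \in E2) || (b j \in E2) && (bs j \in E1)) ->
  forall A a a', a != a' -> \sum_j w (upd (upd A a (b j)) a' (bs j)) = 0.
Proof.
move=> ws hb A a a' aa'; apply: big1 => j _.
have [ra ra'] : row a (upd (upd A a (b j)) a' (bs j)) = b j /\
    row a' (upd (upd A a (b j)) a' (bs j)) = bs j.
  by rewrite row_upd_ne // !row_upd.
case/orP: (hb j) => /andP[h1 h2]; first by apply: (ws _ a a'); rewrite ?ra ?ra'.
by apply: (ws _ a' a); rewrite ?ra ?ra' 1?eq_sym.
Qed.

End Adapted.
End Frames.

Lemma alg_ideal_separated n D E1 E2 E1' E2' th Om (w0 w : 'M[R]_(n, m) -> R) :
  (0 < n)%N ->
  let om u v := Om (col_mx u v) in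
  (forall a u v x, om (a *: u + v) x = a * om u x + om v x) ->
  (forall u v, om u v = - om v u) ->
  (forall u, u \in D -> (forall v, v \in D -> om u v = 0) -> u = 0) ->
  (forall u, u \in D -> th u = 0) ->
  splits D n E1 E2 -> isotropic_for om E1 -> isotropic_for om E2 ->
  splits D n E1' E2' -> isotropic_for om E1' -> isotropic_for om E2' ->
  multilinear w -> Defs.alternating w -> separated E1 E2 w ->
  multilinear w0 -> Defs.alternating w0 -> separated E1' E2' w0 ->
  alg_ideal th Om w0 w ->
  exists c, forall A, (forall i, row i A \in D) -> w A = c * w0 A.
Proof.
move=> n0 om om_lin om_skew om_nondeg th0 sp iso1 iso2 sp' iso1' iso2'.
move=> wl wa ws w0l w0a w0s wI.
have [b [bs [fr bsE bE]]] := adapted_frame om_lin om_skew om_nondeg sp iso1 iso2.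
have [b' [bs' [fr' _ bE']]] := adapted_frame om_lin om_skew om_nondeg sp' iso1' iso2'.
have J0 : (0 < #|{: 'I_n + 'I_n}|)%N by rewrite card_sum !card_ord addn_gt0 n0.
have thb j : th (b j) = 0 by apply/th0/(frame_in fr).
have [c cP] := alg_ideal_orthogonal J0 thb w0l w0a wI.
pose F A := w A - c * w0 A.
have Fl : multilinear F by exact: multilin_sub.
(* [F] serves as its own test form, so its contraction with [Om] must vanish. Summing over the
   second index replaces [b y] by [bs x]; the trace of [w] is zero in this frame, and that of [w0]
   is zero once computed in the frame [b']. *)
have F0 : \sum_I F (rows_of b I) * F (rows_of b I) = 0.
  apply: cP => A a a' aa'.
  under eq_bigr => x _ do rewrite -(multilin_upd_sum Fl) -bsE.
  rewrite sumrB -mulr_sumr (separated_trace ws bE) // add0r.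
  rewrite (frame_trace fr fr' (F := fun u v => w0 (upd (upd A a u) a' v))) /=.
  - by rewrite (separated_trace w0s bE') // mulr0 oppr0.
  - move=> I x y v; rewrite updC // multilin_upd_sum //.
    by apply: eq_bigr => i _; rewrite (updC _ _ _ aa').
  - by move=> I x y v; rewrite multilin_upd_sum.
exists c => A AD; apply/eqP; rewrite -subr_eq0; apply/eqP.
apply: (span_vanish Fl (b := b)) AD => [v vD|I].
  by exists (fun j => om v (bs j)); exact: frame_expand vD.
have /eqP := F0; rewrite psumr_eq0 => [/allP/(_ I)|J _]; last by rewrite -expr2 sqr_ge0.
by rewrite mem_index_enum => /(_ isT) /=; rewrite mulf_eq0 orbb => /eqP.
Qed.

End SymplecticFrames.

(** * Linear algebra at one point: the form determines the pair *)

Section PairUniqueness.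
Local Open Scope ring_scope.
Context {R : realType} {m : nat}.
Implicit Types (u v : 'rV[R]_m) (D E : {vspace 'rV[R]_m}).

(** If [x] and [y] were independent, complete them to a basis of [E]. On basis vectors [al]
    vanishes, either because one is repeated or because a permutation brings [x], [y] to the first
    two slots; then [al] is zero on [E]. *)
Lemma volume_dependent n E (al : 'M[R]_(n.+2, m) -> R) x y :
  \dim E = n.+2 -> multilinear al -> Defs.alternating al ->
  (exists A, (forall i, row i A \in E) /\ al A != 0) -> x \in E -> y \in E ->
  (forall A, (forall i, row i A \in E) -> row ord0 A = x ->
     row (lift ord0 ord0) A = y -> al A = 0) ->
  ~~ free [:: x; y].
Proof.
move=> dE all_ ala [A [AE alA]] xE yE al0; apply/negP => fxy.
pose X := [:: x; y] ++ vbasis (E :\: <<[:: x; y]>>).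
have sxy : (<<[:: x; y]>> <= E)%VS by apply/span_subvP => z; rewrite !inE => /orP[]/eqP->.
have Xb : basis_of E X.
  have -> : E = (<<[:: x; y]>> + (E :\: <<[:: x; y]>>))%VS.
    by rewrite [RHS]addvC addv_diff; apply/esym/addv_idPl.
  apply: cat_basis; rewrite ?vbasisP ?basisEfree ?fxy ?subvv ?dim_span //.
  by apply/directv_addP; rewrite capvC capv_diff.
have sX : size X = n.+2 by rewrite -dE (size_basis (X := in_tuple X) Xb).
pose b (i : 'I_n.+2) := X`_i.
have bE i : b i \in E by apply: (basis_mem Xb); rewrite mem_nth ?sX.
move/eqP: alA; apply.
apply: (span_vanish all_ (b := b)) AE => [v|I].
  rewrite -(span_basis Xb) => vX; have /eqP sX' := sX.
  by exists (fun i => vector.coord (Tuple sX') i v); exact: (coord_span (X := Tuple sX')).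
have [/injectiveP Ii|/injectivePn [i [j ij Iij]]] := boolP (injectiveb I); last first.
  by apply: (ala _ i j ij); rewrite !row_rows_of Iij.
have -> : rows_of b I = row_perm (perm Ii) (\matrix_(i, j) b i 0 j).
  by apply/matrixP => i j; rewrite !mxE permE.
have rb i : row i (\matrix_(i, j) b i 0 j) = b i by apply/rowP => j; rewrite !mxE.
by rewrite alt_row_perm // al0 ?mulr0 // => *; rewrite rb.
Qed.

(** Let [pi] be the projection to [E1] along [E2]. Any [pi x] and [pi y], with [x] in [E1'] and [y]
    in [E2'], are dependent. If neither [E1'] nor [E2'] projects to zero, all projections lie on one
    line, although they span [E1], of dimension at least 2. *)
Lemma volume_half n D E1 E2 E1' E2' (al : 'M[R]_(n.+2, m) -> R) :
  splits D n.+2 E1 E2 -> splits D n.+2 E1' E2' ->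
  multilinear al -> Defs.alternating al ->
  (forall A i, row i A \in E2 -> al A = 0) ->
  (exists A, (forall i, row i A \in E1) /\ al A != 0) ->
  (forall A, row ord0 A \in E1' -> row (lift ord0 ord0) A \in E2' ->
     (forall i : 'I_n.+2, (1 < i)%N -> row i A \in E1) -> al A = 0) ->
  (E1' <= E2)%VS \/ (E2' <= E2)%VS.
Proof.
move=> [d1 d2 DE cap] [d1' d2' DE' _] all_ ala alk alv al0.
pose i1 : 'I_n.+2 := lift ord0 ord0.
pose pi := daddv_pi E1 E2; pose pi' := daddv_pi E2 E1.
have piE v : v \in D -> pi v + pi' v = v.
  by rewrite DE => vD; exact: daddv_pi_add.
have sub1 v : v \in E1' -> v \in D by move=> vE; rewrite DE' (subvP (addvSl _ _)).
have sub2 v : v \in E2' -> v \in D by move=> vE; rewrite DE' (subvP (addvSr _ _)).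
have dep x y : x \in E1' -> y \in E2' -> ~~ free [:: pi x; pi y].
  move=> xE yE; apply: (volume_dependent d1 all_ ala alv) => [||A AE A0 A1].
  - exact: memv_pi.
  - exact: memv_pi.
  have i10 : i1 != ord0 by [].
  have kill B i v : v \in E2 -> al (upd B i v) = 0.
    by move=> vE; apply: (alk _ i); rewrite row_upd.
  (* The first two rows of [A] are [pi x] and [pi y]; the complementary parts of [x] and [y] lie in
     [E2] and are killed by [al]. *)
  have <- : al (upd (upd A ord0 x) i1 y) = al A.
    rewrite -{1}(piE _ (sub2 _ yE)) multilin_updD // [X in _ + X]kill ?memv_pi // addr0.
    rewrite updC // -{1}(piE _ (sub1 _ xE)) multilin_updD // [X in _ + X]kill ?memv_pi // addr0.
    by rewrite -A1 upd_row -A0 upd_row.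
  apply: al0 => [||i hi]; rewrite ?row_upd //.
    by rewrite row_upd_ne 1?eq_sym // row_upd.
  by rewrite !row_upd_ne // -val_eqE /=; case: (val i) hi => [|[]].
have subE2 E : (forall v, v \in E -> v \in D) ->
    (forall v, v \in E -> pi v = 0) -> (E <= E2)%VS.
  move=> ED E0; apply/subvP => v vE.
  by rewrite -(piE v (ED v vE)) (E0 v vE) add0r memv_pi.
have [h|] := pselect (forall x, x \in E1' -> pi x = 0); first by left; exact: subE2.
move=> /existsNP [x0 /not_implyP [x0E /eqP x0n]].
have [h|] := pselect (forall y, y \in E2' -> pi y = 0); first by right; exact: subE2.
move=> /existsNP [y0 /not_implyP [y0E /eqP y0n]].
have line1 x : x \in E1' -> pi x \in <[pi y0]>%VS.
  move=> xE; have := dep x y0 xE y0E.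
  by rewrite free_cons seq1_free y0n andbT negbK span_seq1.
have line2 y : y \in E2' -> pi y \in <[pi y0]>%VS.
  move=> yE; have := dep x0 y x0E yE.
  rewrite free_cons seq1_free negb_and !negbK span_seq1 => /orP[|/eqP ->]; last exact: mem0v.
  move=> /vlineP [k xk]; have k0 : k != 0 by apply: contraNneq x0n => k0; rewrite xk k0 scale0r.
  by rewrite -[pi y]scale1r -(mulVf k0) -scalerA -xk memvZ // line1.
have : (E1 <= <[pi y0]>)%VS.
  apply/subvP => v vE; rewrite -(daddv_pi_id cap vE) -/pi.
  have : v \in D by rewrite DE (subvP (addvSl _ _)).
  rewrite DE' => /memv_addP [x xE [y yE ->]].
  by rewrite linearD; apply: memvD; [exact: line1 | exact: line2].
by move/dimvS; rewrite d1 dim_vline y0n.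
Qed.

Lemma split_pair_unique n D E1 E2 E1' E2' (w al be : 'M[R]_(n, m) -> R) :
  (3 <= n)%N -> splits D n E1 E2 -> splits D n E1' E2' ->
  multilinear al -> Defs.alternating al -> multilinear be -> Defs.alternating be ->
  (forall A, w A = al A - be A) ->
  (forall A i, row i A \in E2 -> al A = 0) ->
  (forall A i, row i A \in E1 -> be A = 0) ->
  (exists A, (forall i, row i A \in E1) /\ al A != 0) ->
  (exists A, (forall i, row i A \in E2) /\ be A != 0) ->
  (forall A i j, i != j -> (forall i, row i A \in D) ->
     row i A \in E1' -> row j A \in E2' -> w A = 0) ->
  (E1' = E1 /\ E2' = E2) \/ (E1' = E2 /\ E2' = E1).
Proof.
case: n w al be => [|[|[|n]]] // w al be _ sp sp' all_ ala bel bea wE alk bek alv bev ws.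
have sps : splits D n.+3 E2 E1.
  by have [? ? ? ?] := sp; split; rewrite // 1?addvC 1?capvC.
have [d1 d2 DE cap] := sp; have [d1' d2' DE' _] := sp'.
have sub1 : (E1 <= D)%VS by rewrite DE addvSl.
have sub2 : (E2 <= D)%VS by rewrite DE addvSr.
have sub1' : (E1' <= D)%VS by rewrite DE' addvSl.
have sub2' : (E2' <= D)%VS by rewrite DE' addvSr.
have w0 E A : (E <= D)%VS -> row ord0 A \in E1' -> row (lift ord0 ord0) A \in E2' ->
    (forall i : 'I_n.+3, (1 < i)%N -> row i A \in E) -> w A = 0.
  move=> ED A0 A1 A2; apply: (ws _ ord0 (lift ord0 ord0)) => // i.
  have [i1|] := ltnP 1 i; first exact/(subvP ED)/A2.
  rewrite leq_eqVlt => /orP[/eqP i1|].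
    by rewrite (_ : i = lift ord0 ord0) ?(subvP sub2') //; exact/val_inj.
  by rewrite ltnS leqn0 => /eqP i0; rewrite (_ : i = ord0) ?(subvP sub1') //; exact/val_inj.
(* This is where the degree must be at least 3: besides the slots of [x] and [y] there is a slot 2,
   whose argument in [E1] kills [be], and in [E2] kills [al]. *)
pose i2 : 'I_n.+3 := inord 2; have i2v : (1 < i2)%N by rewrite inordK.
have ha : (E1' <= E2)%VS \/ (E2' <= E2)%VS.
  apply: (volume_half sp sp' all_ ala alk alv) => A A0 A1 A2.
  by have := w0 _ _ sub1 A0 A1 A2; rewrite wE (bek _ _ (A2 i2 i2v)) subr0.
have hb : (E1' <= E1)%VS \/ (E2' <= E1)%VS.
  apply: (volume_half sps sp' bel bea bek bev) => A A0 A1 A2.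
  have := w0 _ _ sub2 A0 A1 A2; rewrite wE (alk _ _ (A2 i2 i2v)) sub0r.
  by move/eqP; rewrite oppr_eq0 => /eqP.
(* No space of positive dimension lies in both [E1] and [E2], which excludes two of the four
   combinations; in the other two, equal dimensions turn inclusions into equalities. *)
have eqd E F : \dim E = n.+3 -> \dim F = n.+3 -> (E <= F)%VS -> E = F.
  by move=> dE dF EF; apply/eqP; rewrite eqEdim EF dE dF leqnn.
have nocap E : \dim E = n.+3 -> (E <= E1)%VS -> (E <= E2)%VS -> False.
  move=> dE h1 h2; have : (E <= E1 :&: E2)%VS by rewrite subv_cap h1 h2.
  by rewrite cap => /dimvS; rewrite dE dimv0.
case: ha hb => [h1|h1] [h2|h2].
- by case: (nocap _ d1' h2 h1).
- by right; split; apply: eqd.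
- by left; split; apply: eqd.
- by case: (nocap _ d2' h2 h1).
Qed.

End PairUniqueness.

(** * Calculus in charts: the exterior derivative of a 1-form *)

Section LocalCoordinates.
Local Open Scope ring_scope.
Context {R : realType} {m : nat} {M : smooth_manifold R m}.
Implicit Types (p q : M) (c : chart R m M) (U : set M).

Lemma coord_near c p : dom c p ->
  \forall x \near coord c p, (coord c @` dom c) x.
Proof.
by move=> cp; apply: open_nbhs_nbhs; split; [exact: open_im | exists p].
Qed.

Lemma icoord_near c p U : dom c p -> open U -> U p ->
  \forall x \near coord c p, U (icoord c x).
Proof.
move=> cp oU Up; have := @icoord_cont _ _ _ c.
rewrite continuous_open_subspace; last exact: open_im.
move=> /(_ (coord c p)) cont; apply: cont; first by rewrite inE; exists p.
by rewrite /= coordK //; apply: open_nbhs_nbhs.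
Qed.

Lemma coord_continuous_at c p : dom c p -> {for p, continuous (coord c)}.
Proof.
move=> cp; have := @coord_cont _ _ _ c.
rewrite continuous_open_subspace; last exact: open_dom.
by apply; rewrite inE.
Qed.

Section ExteriorDerivative.
Variables (U : set M) (th : cfield M 1) (p : M).
Hypotheses (oU : open U) (thU : dform U th) (Up : U p).

Let c := chart_at p.
Let g (v : 'rV[R]_m) (x : 'rV[R]_m) : R := cfield_in c th x v.

Let dg v : differentiable (g v) (coord c p).
Proof.
have [_ /(_ c (chart_at_atlas p) v [::])] := thU.
by apply; exists p => //; split => //; exact: chart_at_dom.
Qed.

Let D_lin (a : R) u v x : 'D_x (g (a *: u + v)) (coord c p) =
  a * 'D_x (g u) (coord c p) + 'D_x (g v) (coord c p).
Proof.
transitivity ('D_x (a \*: g u + g v) (coord c p)); last first.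
  rewrite deriveD; [|apply: derivableZ; exact: diff_derivable|exact: diff_derivable].
  by rewrite deriveZ //; exact: diff_derivable.
(* Linearity of [th] is known at the points of [U] only, so the two functions are compared near
   [coord c p]. *)
apply: near_eq_derive.
have := icoord_near (chart_at_dom p) oU Up; apply: filterS => y Uy.
have [+ _] := thU; move=> /(_ _ Uy) [thl _].
rewrite /g /cfield_in -[X in _ = _ + X]mul1r; apply: (thl _ _ _ ord0).
- by rewrite !row_id mulmxDl -scalemxAl scale1r.
- by apply/matrixP => -[].
- by apply/matrixP => -[].
Qed.

Lemma ext_d1E (u v : 'rV[R]_m) : ext_d th p (col_mx u v) =
  'D_u (g v) (coord c p) - 'D_v (g u) (coord c p).
Proof.
rewrite /ext_d big_ord_recl big_ord1 expr0 mul1r expr1 mulN1r.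
pose A : 'M[R]_(2, m) := col_mx u v.
have [r0 r1] : row ord0 A = u /\ row (lift ord0 ord0) A = v.
  by split; apply/rowP => j; rewrite !mxE; case: splitP => k; rewrite ?ord1.
have [s0 s1] : row' ord0 A = v /\ row' (lift ord0 ord0) A = u.
  by split; apply/rowP => j; rewrite !mxE; case: splitP => k; rewrite ?ord1.
by rewrite -/A r0 r1 s0 s1.
Qed.

Lemma ext_d1_lin (a : R) (u v x : 'rV[R]_m) : ext_d th p (col_mx (a *: u + v) x) =
  a * ext_d th p (col_mx u x) + ext_d th p (col_mx v x).
Proof.
have Du : 'D_(a *: u + v) (g x) (coord c p) =
    a * 'D_u (g x) (coord c p) + 'D_v (g x) (coord c p) :> R.
  by rewrite !deriveE // linearP.
by rewrite !ext_d1E D_lin Du opprD addrACA -mulrBr.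
Qed.

Lemma ext_d1_skew (u v : 'rV[R]_m) : ext_d th p (col_mx u v) = - ext_d th p (col_mx v u).
Proof. by rewrite !ext_d1E opprB. Qed.

End ExteriorDerivative.

(** The change of coordinates from a chart to itself is the identity near the point, so the
    Jacobian, read as a derivative in the direction [X p], returns [X p]. *)
Lemma vfield_in_chart_at (X : vfield M) p :
  vfield_in (chart_at p) X (coord (chart_at p) p) = X p.
Proof.
have cp := chart_at_dom p.
rewrite /vfield_in coordK // -deriveEjacobian; last first.
  have := @atlas_compat _ _ M _ _ (chart_at_atlas p) (chart_at_atlas p) [::].
  by apply; exists p.
rewrite -[RHS](derive_id (coord (chart_at p) p)); apply: near_eq_derive.
by have := coord_near cp; apply: filterS => x [q cq <-] /=; rewrite coordK.
Qed.

End LocalCoordinates.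

(** * Openness of transversality, and connected sets *)

Lemma cvg_det_mulmx (R : realType) (T : Type) (F : set_system T) m n
    (A : T -> 'M[R]_(n, m)) (A0 : 'M[R]_(n, m)) (B : 'M[R]_(m, n)) : Filter F ->
  (forall i j, A x i j @[x --> F] --> A0 i j)%R ->
  ((\det (A x *m B))%R @[x --> F] --> (\det (A0 *m B))%R).
Proof.
move=> FF AA0; rewrite /determinant.
apply: cvg_big; first exact: add_continuous.
move=> s _; apply: cvgM; first exact: cvg_cst.
apply: cvg_big; [exact: mul_continuous | move=> i _; rewrite mxE].
under eq_cvg do rewrite mxE.
apply: cvg_big; first exact: add_continuous.
by move=> k _; apply: cvgM; [exact: AA0 | exact: cvg_cst].
Qed.

Lemma lines_sum_free (K : fieldType) (vT : vectType K) n (x : 'I_n -> vT) :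
  \dim (\sum_(i < n) <[x i]>) = n ->
  forall a : 'I_n -> K, (\sum_i a i *: x i = 0 -> forall i, a i = 0)%R.
Proof.
move=> dx a.
have xn (i : 'I_n) : ([tuple x i | i < n]`_i)%R = x i by rewrite -tnth_nth tnth_mktuple.
have /freeP fx : free [tuple x i | i < n].
  by rewrite /free size_tuple -[X in _ == X]dx span_def big_map big_enum.
by move=> ax; apply: fx; rewrite -[RHS]ax; apply: eq_bigr => i _; rewrite xn.
Qed.

Section Transversality.
Local Open Scope ring_scope.
Context {R : realType} {m : nat} {M : smooth_manifold R m}.
Implicit Types (p q : M) (U : set M).

(** Stack local frames of [E] and [F] into a matrix [N q]. Transversality at [p] gives [N p] a right
    inverse [B]; in coordinates, the determinant of the product with this fixed [B] is continuous
    and equals 1 at [p], and where it is non-zero the rows are still independent. *)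
Lemma transverse_near U V n r (E F : subbundle_field M) p :
  smooth_subbundle U n E -> U p -> smooth_subbundle V r F -> V p ->
  (E p :&: F p = 0)%VS -> \forall q \near p, (E q :&: F q = 0)%VS.
Proof.
move=> /[apply] -[U' [X [[oU' U'p _] [Xs XE]]]] /[apply] -[V' [Y [[oV' V'p _] [Ys YF]]]] EF.
have cp := chart_at_dom p; set c := chart_at p in cp.
pose N q : 'M[R]_(n + r, m) := col_mx (\matrix_i X i q) (\matrix_j Y j q).
pose Nc x : 'M[R]_(n + r, m) :=
  col_mx (\matrix_i vfield_in c (X i) x) (\matrix_j vfield_in c (Y j) x).
(* [N q] has its components in [chart_at q], which need not vary continuously with [q]; [Nc] holds
   the same vectors in the fixed chart [c]. A linear relation between the rows of [N q] carries over
   to [Nc]. *)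
have NcN q : dom c q -> exists J : 'M[R]_m, Nc (coord c q) = N q *m J.
  move=> cq; exists ('J (coord c \o icoord (chart_at q)) (coord (chart_at q) q)).
  rewrite mul_col_mx; congr col_mx; apply/row_matrixP => i;
    by rewrite rowK row_mul rowK /vfield_in coordK.
have Ncp : Nc (coord c p) = N p.
  by congr col_mx; apply/row_matrixP => i; rewrite !rowK vfield_in_chart_at.
have Nu x j k : Nc x (lshift r j) k = vfield_in c (X j) x 0 k by rewrite col_mxEu mxE.
have Nd x j k : Nc x (rshift n j) k = vfield_in c (Y j) x 0 k by rewrite col_mxEd mxE.
have mulN q (a : 'rV[R]_(n + r)) : a *m N q =
    \sum_i lsubmx a 0 i *: X i q + \sum_j rsubmx a 0 j *: Y j q.
  rewrite -{1}(hsubmxK a) mul_row_col !mulmx_sum_row.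
  by congr (_ + _); apply: eq_bigr => i _; rewrite rowK.
clearbody N Nc.
have Np : row_free (N p).
  apply: inj_row_free => a; rewrite mulN => aN.
  have [dE sE] := XE p U'p; have [dF sF] := YF p V'p.
  have XinE : \sum_i lsubmx a 0 i *: X i p \in E p.
    by rewrite sE; apply: memv_sumr => i _; rewrite memvZ ?memv_line.
  have YinF : \sum_j rsubmx a 0 j *: Y j p \in F p.
    by rewrite sF; apply: memv_sumr => i _; rewrite memvZ ?memv_line.
  have X0 : \sum_i lsubmx a 0 i *: X i p = 0.
    apply/eqP; rewrite -memv0 -EF memv_cap XinE /=.
    by rewrite -rpredN (addr0_eq aN).
  have Y0 : \sum_j rsubmx a 0 j *: Y j p = 0 by rewrite X0 add0r in aN.
  rewrite sE in dE; rewrite sF in dF.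
  rewrite -(hsubmxK a) -[RHS]row_mx0; congr row_mx; apply/rowP => i; rewrite [RHS]mxE.
    exact: (lines_sum_free dE X0).
  exact: (lines_sum_free dF Y0).
have /row_freeP [B NB] := Np.
have detn0 : \forall q \near p, \det (Nc (coord c q) *m B) != 0.
  have : \det (Nc (coord c q) *m B) @[q --> p] --> (1 : R).
    rewrite -(det1 R (n + r)) -NB -Ncp.
    apply: (@cvg_det_mulmx R M (nbhs p) _ _ (fun q => Nc (coord c q))) => i k.
    have vc Z W : open W -> W p -> smooth_vfield W Z ->
        vfield_in c Z (coord c q) 0 k @[q --> p] --> vfield_in c Z (coord c p) 0 k.
      move=> oW Wp /(_ c (chart_at_atlas p) [::]) Zs.
      apply: (@continuous_comp _ _ _ (coord c) (fun x => vfield_in c Z x 0 k)).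
        exact: coord_continuous_at.
      apply: (@continuous_comp _ _ _ (vfield_in c Z) (fun x : 'rV_m => x 0 k)).
        by apply/differentiable_continuous/Zs; exists p.
      exact: coord_continuous.
    rewrite -(splitK i); case: (fintype.split i) => j /=.
      by rewrite Nu; under eq_cvg do rewrite Nu; exact: vc (Xs j).
    by rewrite Nd; under eq_cvg do rewrite Nd; exact: vc (Ys j).
  by move=> /cvgr_neq0; apply; exact: oner_neq0.
near=> q.
have U'q : U' q by near: q; exact: open_nbhs_nbhs.
have V'q : V' q by near: q; exact: open_nbhs_nbhs.
have cq : dom c q by near: q; apply: open_nbhs_nbhs; split=> //; exact: open_dom.
have dq : \det (Nc (coord c q) *m B) != 0 by near: q.
have [J NJ] := NcN q cq.
have [dE sE] := XE q U'q; have [dF sF] := YF q V'q.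
apply/eqP; rewrite -subv0; apply/subvP => v; rewrite memv_cap sE sF memv0.
move=> /andP[/memv_sumP [u uX vX] /memv_sumP [w wY vY]].
have /choice [a ua] i : exists a, u i = a *: X i q.
  by have /vlineP [a ua] := uX i isT; exists a.
have /choice [b wb] j : exists b, w j = b *: Y j q.
  by have /vlineP [b wb] := wY j isT; exists b.
(* The difference of the two expansions of [v] is a relation between the rows of [N q]. *)
pose z : 'rV[R]_(n + r) := row_mx (\row_i a i) (- \row_j b j).
have zN : z *m N q = 0.
  rewrite mulN row_mxKl row_mxKr.
  rewrite -[RHS](subrr v) {1}vX vY -sumrN; congr (_ + _); apply: eq_bigr => i _.
    by rewrite mxE ua.
  by rewrite !mxE wb scaleNr.
have z0 : z = 0.
  have Bu : Nc (coord c q) *m B \in unitmx by rewrite unitmxE unitfE.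
  by rewrite -[z](mulmxK Bu) NJ !mulmxA zN !mul0mx.
apply/eqP; rewrite vX big1 // => i _; rewrite ua.
have := congr1 (fun y => lsubmx y 0 i) z0; rewrite row_mxKl !mxE => ->.
by rewrite scale0r.
Unshelve. all: by end_near.
Qed.

End Transversality.

(** Within [A], the sets [G1] and [G2] are complementary, so the trace of [G1] on [A] is both open
    and closed. *)
Lemma connected_dichotomy (T : topologicalType) (A G1 G2 : set T) :
  connected A -> open G1 -> open G2 ->
  (forall p, A p -> G1 p /\ ~ G2 p \/ G2 p /\ ~ G1 p) ->
  (forall p, A p -> G1 p) \/ (forall p, A p -> G2 p).
Proof.
move=> cA o1 o2 dich.
have [A1|/existsNP [p0 /not_implyP [Ap0 n2]]] := pselect (forall p, A p -> G2 p).
  by right.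
left; suff <- : A `&` G1 = A by move=> p [].
apply: cA.
- by exists p0; split => //; case: (dich _ Ap0) => -[].
- by exists G1.
- exists (~` G2); first exact: open_closedC.
  apply/seteqP; split => p [Ap gp]; split => //.
    by case: (dich _ Ap) => -[].
  by case: (dich _ Ap) => -[].
Qed.

(** * Back to Monge-Ampère systems with Lagrangian pairs *)

Section MongeAmperePairs.
Local Open Scope ring_scope.
Context {R : realType} {n : nat} {M : smooth_manifold R n.*2.+1}.
Implicit Types (p : M) (U : set M) (D E : subbundle_field M) (w : cfield M n).

Lemma lagrangian_splits D U E1 E2 p :
  lagrangian_pair D U E1 E2 -> U p -> splits (D p) n (E1 p) (E2 p).
Proof.
move=> [s1 s2 _ _ DE] Up; have [DEp capE] := DE p Up.
by split=> //; [have [V [X [[_ Vp _] [_ /(_ p Vp) []]]]] := s1 p Up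
  | have [V [X [[_ Vp _] [_ /(_ p Vp) []]]]] := s2 p Up].
Qed.

Lemma bi_decomposition_kills U E1 E2 w w1 w2 p :
  bi_decomposition U E1 E2 w w1 w2 -> U p ->
  (forall A i, row i A \in E2 p -> w1 p A = 0) /\
  (forall A i, row i A \in E1 p -> w2 p A = 0).
Proof.
move=> [[[w1f _] [w2f _] _] [k1 k2 _ _]] Up.
have [l1 a1] := w1f p Up; have [l2 a2] := w2f p Up.
split; apply: int_prod_row => // u A uE; first exact: (k1 p u A Up uE).
exact: (k2 p u A Up uE).
Qed.

Lemma bi_decomposition_separated U E1 E2 w w1 w2 p :
  bi_decomposition U E1 E2 w w1 w2 -> U p -> separated (E1 p) (E2 p) (w p).
Proof.
move=> bd Up A i j _ Ai Aj; have [k1 k2] := bi_decomposition_kills bd Up.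
have [[_ _ wE] _] := bd.
by rewrite wE // /cfield_sub (k1 _ _ Aj) (k2 _ _ Ai) subr0.
Qed.

Lemma bi_decomposition_unique D U U' w w1 w2 E1 E2 E1' E2' p :
  (3 <= n)%N -> lagrangian_pair D U E1 E2 -> U p ->
  lagrangian_pair D U' E1' E2' -> U' p ->
  forall W, bi_decomposition W E1 E2 w w1 w2 -> W p ->
  (forall A i j, i != j -> (forall i, row i A \in D p) ->
     row i A \in E1' p -> row j A \in E2' p -> w p A = 0) ->
  (E1' p = E1 p /\ E2' p = E2 p) \/ (E1' p = E2 p /\ E2' p = E1 p).
Proof.
move=> n3 L Up L' Up' W bd Wp ws.
have [k1 k2] := bi_decomposition_kills bd Wp.
have [[[w1f _] [w2f _] wE] [_ _ v1 v2]] := bd.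
have [l1 a1] := w1f p Wp; have [l2 a2] := w2f p Wp.
apply: (split_pair_unique n3 (lagrangian_splits L Up) (lagrangian_splits L' Up')
  l1 a1 l2 a2 _ k1 k2 (v1 p Wp) (v2 p Wp) ws) => A.
by rewrite wE.
Qed.

(** A member of a generated ideal lies in every ideal containing the generators. The ideal [J] used
    here consists of the forms of the system on the overlap [V] whose value at [p] is in
    [alg_ideal]; being taken inside [I V], its members are smooth forms. *)
Lemma generator_in_alg_ideal D I U U' w th' w' p :
  eds I -> open U -> U p -> local_generator D I U w ->
  open U' -> U' p ->
  (forall V, open V -> V `<=` U' -> forall k (eta : cfield M k),
     I V k eta <-> generated_ideal V th' w' eta) ->
  alg_ideal (th' p) (ext_d th' p) (w' p) (w p).
Proof.
move=> [Iid Id _ _] oU Up [th [_ _ gen]] oU' Up' gen'.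
pose V := U `&` U'; have oV : open V by exact: openI.
have Vp : V p by [].
have VU : V `<=` U by move=> q [].
have VU' : V `<=` U' by move=> q [].
have {}gen' k (eta : cfield M k) : I V k eta <-> generated_ideal V th' w' eta.
  exact: gen'.
have IVw : I V n w by apply/(gen V oV VU) => J.
have IVth : I V 1 th' by apply/gen' => J.
have IVdth : I V 2 (ext_d th') by exact: Id.
have IVw' : I V n w' by apply/gen' => J.
have [If Ieq I0 Iadd Iw] := Iid V oV.
pose J k (eta : cfield M k) :=
  I V k eta /\ alg_ideal (th' p) (ext_d th' p) (w' p) (eta p).
suff [] : J n w by [].
have /gen' := IVw; apply.
- split.
  + by move=> k eta [/If].
  + by move=> k eta eta' [Ie ae] df ee; split; [exact: Ieq ee | rewrite -ee].
  + by move=> k; split=> //; exact: AlgZero.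
  + move=> k eta eta' [Ie ae] [Ie' ae']; split; first exact: Iadd.
    exact: (AlgAdd ae ae').
  + move=> k l eta eta' [Ie ae] df; have [h1 h2] := Iw _ _ _ _ Ie df.
    by split; split=> //; [exact: alg_ideal_wedgel | exact: alg_ideal_wedger].
- by split=> //; apply/AlgTh/multiple_id.
- by split=> //; apply/AlgOm/multiple_id.
- by split=> //; apply/AlgW/multiple_id.
Qed.

Lemma system_pair_unique D I E1 E2 E1' E2' p :
  (3 <= n)%N -> monge_ampere_with_pair D I E1 E2 ->
  monge_ampere_with_pair D I E1' E2' ->
  (E1' p = E1 p /\ E2' p = E2 p) \/ (E1' p = E2 p /\ E2' p = E1 p).
Proof.
move=> n3 [[eI _] L hE] [_ L' hE'].
have [U [w [w1 [w2 [oU Up lg bd]]]]] := hE p.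
have [U' [w' [w1' [w2' [oU' Up' [th' [cf' w'f gen'] bd']]]]]] := hE' p.
apply: (bi_decomposition_unique (p := p) n3 L _ L' _ bd) => //.
have wI := generator_in_alg_ideal eI oU Up lg oU' Up' gen'.
have [thf thD thnd] := cf'.
have [wl wa] : multilinear (w p) /\ Defs.alternating (w p).
  by have [th [_ [wf _] _]] := lg; exact: wf.
have [w'l w'a] : multilinear (w' p) /\ Defs.alternating (w' p).
  by have [w'f0 _] := w'f; exact: w'f0.
have iso E : isotropic D setT E ->
    isotropic_for (fun u v => ext_d th' p (col_mx u v)) (E p).
  by move=> Eiso u v; apply: (Eiso U' th').
have [_ _ iso1 iso2 _] := L; have [_ _ iso1' iso2' _] := L'.
have n0 : (0 < n)%N by exact: leq_trans n3.
have [c wc] := alg_ideal_separated n0 (ext_d1_lin oU' thf Up')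
  (ext_d1_skew th' p) (fun u uD => thnd p u Up' uD)
  (fun u uD => (thD p u Up').1 uD)
  (lagrangian_splits L Logic.I) (iso _ iso1) (iso _ iso2)
  (lagrangian_splits L' Logic.I) (iso _ iso1') (iso _ iso2')
  wl wa (bi_decomposition_separated bd Up) w'l w'a
  (bi_decomposition_separated bd' Up') wI.
move=> A i j ij AD Ai Aj.
by rewrite wc // (bi_decomposition_separated bd' Up' ij Ai Aj) mulr0.
Qed.

Lemma same_pair_connected D U U' E1 E2 E1' E2' (A : set M) :
  (0 < n)%N -> open U -> open U' ->
  lagrangian_pair D U E1 E2 -> lagrangian_pair D U' E1' E2' ->
  A `<=` U `&` U' -> connected A ->
  (forall p, A p ->
     (E1' p = E1 p /\ E2' p = E2 p) \/ (E1' p = E2 p /\ E2' p = E1 p)) ->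
  same_unordered_pair A E1 E2 E1' E2'.
Proof.
move=> n0 oU oU' L L' AU cA uniq.
(* On [A], transversality of [E1'] to [E2] means [E1' p = E1 p], and transversality to [E1] means
   [E1' p = E2 p], because a space of positive dimension is not transverse to itself. *)
pose G E : set M := [set p | [/\ U p, U' p & (E1' p :&: E p = 0)%VS]].
have oG E : smooth_subbundle U n E -> open (G E).
  move=> sE; rewrite openE => p [Up Up' cap]; have [sE' _ _ _ _] := L'.
  have nU : \forall q \near p, U q by exact: open_nbhs_nbhs.
  have nU' : \forall q \near p, U' q by exact: open_nbhs_nbhs.
  have nc := transverse_near sE' Up' sE Up cap.
  by rewrite /interior /=; near=> q; split; near: q.
have [s1 s2 _ _ _] := L.
have neq0 p E : \dim (E p) = n -> (E p :&: E p = 0)%VS -> False.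
  by rewrite capvv => dE E0; rewrite E0 dimv0 in dE; rewrite -dE in n0.
have dich p : A p -> G E2 p /\ ~ G E1 p \/ G E1 p /\ ~ G E2 p.
  move=> Ap; have [Up Up'] := AU p Ap.
  have [d1 d2 _ cap] := lagrangian_splits L Up.
  case: (uniq p Ap) => -[e1 e2]; [left|right]; (split; first split=> //).
  - by rewrite e1.
  - by move=> [_ _]; rewrite e1 => /neq0; apply.
  - by rewrite e1 capvC.
  - by move=> [_ _]; rewrite e1 => /neq0; apply.
case: (connected_dichotomy cA (oG _ s2) (oG _ s1) dich) => GA; [left|right] => p Ap.
- have [Up Up'] := AU p Ap; have [d1 d2 _ cap] := lagrangian_splits L Up.
  case: (uniq p Ap) => // -[e1 e2]; have [_ _] := GA p Ap.
  by rewrite e1 => /(neq0 _ _ d2).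
- have [Up Up'] := AU p Ap; have [d1 d2 _ cap] := lagrangian_splits L Up.
  case: (uniq p Ap) => // -[e1 e2]; have [_ _] := GA p Ap.
  by rewrite e1 => /(neq0 _ _ d1).
Unshelve. all: by end_near.
Qed.

End MongeAmperePairs.

Theorem theorem3p8 (R : realType) (n : nat) (hn : (3 <= n)%N)
    (M : smooth_manifold R n.*2.+1) (D : subbundle_field M)
    (hD : contact_structure D)
    (I : set M -> forall k, set (cfield M k))
    (E1 E2 : subbundle_field M)
    (hI : monge_ampere_with_pair D I E1 E2) :
  (* the system determines the pair *)
  (forall E1' E2' : subbundle_field M,
     monge_ampere_with_pair D I E1' E2' ->
     forall A : set M, connected A -> same_unordered_pair A E1 E2 E1' E2')
  /\
  (* so does each of its local generators *)
  (forall (U : set M) (w w1 w2 w1' w2' : cfield M n)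
          (E1' E2' : subbundle_field M),
     open U -> local_generator D I U w ->
     bi_decomposition U E1 E2 w w1 w2 ->
     lagrangian_pair D U E1' E2' ->
     bi_decomposition U E1' E2' w w1' w2' ->
     forall A : set M, A `<=` U -> connected A ->
       same_unordered_pair A E1 E2 E1' E2').
Proof.
have n0 : (0 < n)%N by exact: leq_trans hn.
have [_ L _] := hI.
split=> [E1' E2' hI' A cA|U w w1 w2 w1' w2' E1' E2' oU lg bd L' bd' A AU cA].
  have [_ L' _] := hI'.
  apply: (same_pair_connected n0 openT openT L L' _ cA) => // p _.
  exact: system_pair_unique hI hI'.
apply: (same_pair_connected n0 openT oU L L' _ cA) => [p Ap|p /AU Up].
  by split=> //; exact: AU.
(* Both decompositions are of the same [w], so its vanishing on mixed arguments of the second pair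
   is immediate. *)
apply: (bi_decomposition_unique hn L _ L' Up bd Up) => // B i j ij _.
exact: (bi_decomposition_separated bd' Up).
Qed.
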